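(* The superalgebra $\mathcal{B}$ is a super-prime ring.
   Context: Let $\Bbbk$ be a (commutative) field of characteristic $p \neq 2$ ($p=0$ is allowed). The super Jordan plane $\mathcal{B}$ is the associative unital $\Bbbk$-algebra presented by generators $x, y$ with defining relations $x^2 = 0$ and $yz - zy - xz = 0$, where $z = xy + yx$. The relations are homogeneous for $\deg x = \deg y = 1$, so $\mathcal{B}$ is $\mathbb{Z}$-graded, and it is a superalgebra ($\mathbb{Z}/2\mathbb{Z}$-graded algebra) $\mathcal{B} = \mathcal{B}_0 \oplus \mathcal{B}_1$, where $\mathcal{B}_0$ (respectively $\mathcal{B}_1$) is the sum of the components of even (respectively odd) degree. A superalgebra $R = R_0 \oplus R_1$ is super-prime if, for all homogeneous elements $f, g \in R_0 \cup R_1$, $fRg = 0$ implies $f = 0$ or $g = 0$. *)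

(* Defs.v *)
From HB Require Import structures.
From mathcomp Require Import all_boot all_algebra finmap.
From mathcomp Require Import boolp monalg.

Set Implicit Arguments.
Unset Strict Implicit.
Unset Printing Implicit Defensive.

Import GRing.Theory.
Local Open Scope ring_scope.

Section TwoSidedIdeal.
Variables (R : nzRingType) (rels : seq R).

(* The two-sided ideal of R generated by the elements of rels. *)
Inductive ideal_gen : R -> Prop :=
| ideal_gen_rel r : r \in rels -> ideal_gen r
| ideal_gen0 : ideal_gen 0
| ideal_genB f g : ideal_gen f -> ideal_gen g -> ideal_gen (f - g)
| ideal_genMl a f : ideal_gen f -> ideal_gen (a * f)
| ideal_genMr a f : ideal_gen f -> ideal_gen (f * a).

Definition ideal_pred : {pred R} := fun f => `[< ideal_gen f >].

Lemma ideal_predP f : reflect (ideal_gen f) (f \in ideal_pred).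
Proof. exact: asboolP. Qed.

Lemma ideal_pred_zmod_closed : zmod_closed ideal_pred.
Proof.
split=> [|f g /ideal_predP If /ideal_predP Ig]; apply/ideal_predP.
- exact: ideal_gen0.
- exact: ideal_genB.
Qed.

HB.instance Definition _ :=
  GRing.isZmodClosed.Build R ideal_pred ideal_pred_zmod_closed.

Lemma ideal_predMl a f : f \in ideal_pred -> a * f \in ideal_pred.
Proof. by move=> /ideal_predP If; apply/ideal_predP/ideal_genMl. Qed.

Lemma ideal_predMr a f : f \in ideal_pred -> f * a \in ideal_pred.
Proof. by move=> /ideal_predP If; apply/ideal_predP/ideal_genMr. Qed.

Lemma ideal_pred_mulB f f' g g' :
  f' - f \in ideal_pred -> g' - g \in ideal_pred ->
  f' * g' - f * g \in ideal_pred.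
Proof.
move=> If Ig; rewrite -(subrKA (f * g')) -mulrBl -mulrBr.
by apply: rpredD; [exact: ideal_predMr|exact: ideal_predMl].
Qed.

Lemma ideal_pred_rmorph (S : nzRingType) (phi : {rmorphism R -> S}) :
  (forall r, r \in rels -> phi r = 0) ->
  forall f, f \in ideal_pred -> phi f = 0.
Proof.
move=> phi0 f /ideal_predP; elim=> [//|||a g _ IH|a g _ IH].
- exact: rmorph0.
- by move=> g h _ IHg _ IHh; rewrite rmorphB IHg IHh subr0.
- by rewrite rmorphM IH mulr0.
- by rewrite rmorphM IH mul0r.
Qed.

End TwoSidedIdeal.

Lemma ideal_pred_scaleB (K : nzRingType) (A : lalgType K) (rels : seq A) c f f' :
  f' - f \in ideal_pred rels -> c *: f' - c *: f \in ideal_pred rels.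
Proof. by move=> If; rewrite -scalerBr -mulr_algl; exact: ideal_predMl. Qed.

Lemma augmentation_rel (R S : nzRingType) (phi : {rmorphism R -> S}) (x y z : R) :
  phi x = 0 -> phi y = 0 -> phi (y * z - z * y - x * z) = 0.
Proof.
by move=> x0 y0; rewrite !rmorphB !rmorphM x0 y0 mulr0 !mul0r !subr0.
Qed.

Section Superalgebra.
Variable k : fieldType.

(* The part indexed by a boolean e is R_0 for e = false, R_1 for e = true. *)
Structure superalgType := SuperAlg {
  superalg_sort :> algType k;
  spart : bool -> superalg_sort -> Prop;
  spart0 : forall e, spart e 0;
  spart_linear : forall e (a : k) u v,
    spart e u -> spart e v -> spart e (a *: u + v);
  spart1 : spart false 1;
  spartM : forall d e u v, spart d u -> spart e v -> spart (d (+) e) (u * v);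
  spart_sum : forall u, exists u0 u1,
    [/\ spart false u0, spart true u1 & u = u0 + u1];
  spart_direct : forall u, spart false u -> spart true u -> u = 0
}.

Definition homogeneous (R : superalgType) (f : R) : Prop :=
  spart false f \/ spart true f.

Definition super_prime (R : superalgType) : Prop :=
  forall f g : R, homogeneous f -> homogeneous g ->
    (forall r : R, f * r * g = 0) -> f = 0 \/ g = 0.

End Superalgebra.

(* The free algebra k<x, y>, as the monoid algebra of the free monoid on two
   letters; fdeg m is the length of the word m. *)
Notation freealg2 k := {malg k[{fmonom 'I_2}]}.

(* The summand of f carried by the words of length of parity e; locked, as the
   unfolding of monoid algebra operations makes unification very slow. *)
HB.lock Definition fproj (k : fieldType) (e : bool) (f : freealg2 k) :
    freealg2 k :=
  \sum_(m <- msupp f | odd (fdeg m) == e) (<< f@_m *g m >> : freealg2 k).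

Section Ideal.
Variable k : fieldType.
Local Notation freealg2 := (freealg2 k).

Implicit Types f g h : freealg2.

Lemma freealg2_scalerAr (c : k) (f g : freealg2) : c *: (f * g) = f * (c *: g).
Proof.
have cC (h : freealg2) : c%:MP * h = h * c%:MP.
  rewrite malgM_def (fgmulUg c mone h) malgM_def (fgmulgU c mone h).
  by apply: eq_bigr => m _; rewrite mul1m mulm1 mulrC.
by rewrite -!mul_malgC !mulrA cC.
Qed.

Definition freeX : freealg2 := << fmu (0 : 'I_2) >>.
Definition freeY : freealg2 := << fmu (1 : 'I_2) >>.
Definition freeZ : freealg2 := freeX * freeY + freeY * freeX.

Definition sjp_rels : seq freealg2 :=
  [:: freeX ^+ 2; freeY * freeZ - freeZ * freeY - freeX * freeZ].

Definition sjp_ideal : {pred freealg2} := ideal_pred sjp_rels.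
HB.instance Definition _ := GRing.ZmodClosed.on sjp_ideal.

Definition fparity (e : bool) (f : freealg2) : Prop :=
  forall m, m \in msupp f -> odd (fdeg m) = e.

Lemma fproj_coef e f m :
  (fproj e f)@_m = if odd (fdeg m) == e then f@_m else 0.
Proof.
rewrite unlock raddf_sum /=; under eq_bigr do rewrite mcoeffU.
have [mf|mf] := boolP (m \in msupp f).
  rewrite -big_filter; case: ifP => me.
    rewrite (bigD1_seq m) ?filter_uniq ?mem_filter ?me ?fset_uniq //=.
    by rewrite eqxx big1 ?addr0 // => i /negPf->.
  rewrite big_filter big1 // => i /eqP ie; case: eqP => // im.
  by rewrite -im ie eqxx in me.
rewrite mcoeff_outdom // if_same big_seq_cond big1 // => i /andP[iif _].
by case: eqP => // im; rewrite -im iif in mf.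
Qed.

Lemma fprojP e f : fparity e (fproj e f).
Proof.
move=> m; rewrite -mcoeff_neq0 fproj_coef.
by case: ifP => [/eqP //|_]; rewrite eqxx.
Qed.

Lemma fproj_id e f : fparity e f -> fproj e f = f.
Proof.
move=> Pf; apply/malgP => m; rewrite fproj_coef; case: eqP => // me.
by symmetry; apply: mcoeff_outdom; apply/negP => /Pf.
Qed.

Lemma fproj_0 e f : fparity (~~ e) f -> fproj e f = 0.
Proof.
move=> Pf; apply/malgP => m; rewrite fproj_coef mcoeff0; case: eqP => // me.
by apply: mcoeff_outdom; apply/negP => /Pf; rewrite me; case: (e).
Qed.

Lemma fprojB e f g : fproj e (f - g) = fproj e f - fproj e g.
Proof.
apply/malgP => m; rewrite (mcoeffB m (fproj e f) (fproj e g)) 3!fproj_coef (mcoeffB m f g).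
by case: ifP => //; rewrite subr0.
Qed.

Lemma fprojD e f g : fproj e (f + g) = fproj e f + fproj e g.
Proof.
apply/malgP => m; rewrite (mcoeffD m (fproj e f) (fproj e g)) 3!fproj_coef (mcoeffD m f g).
by case: ifP => //; rewrite addr0.
Qed.

Lemma fproj_split e f : f = fproj e f + fproj (~~ e) f.
Proof.
apply/malgP => m; rewrite mcoeffD !fproj_coef.
by case: (odd _) e => [] []; rewrite ?addr0 ?add0r.
Qed.

Lemma fparityB e f g : fparity e f -> fparity e g -> fparity e (f - g).
Proof. by move=> /fproj_id <- /fproj_id <-; rewrite -fprojB; apply: fprojP. Qed.

Lemma fparityD e f g : fparity e f -> fparity e g -> fparity e (f + g).
Proof. by move=> /fproj_id <- /fproj_id <-; rewrite -fprojD; apply: fprojP. Qed.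

Lemma fparity0 e : fparity e 0.
Proof. by move=> m; rewrite -mcoeff_neq0 mcoeff0 eqxx. Qed.

Lemma fparityZ e (c : k) f : fparity e f -> fparity e (c *: f).
Proof.
move=> Pf m; rewrite -mcoeff_neq0 mcoeffZ mulf_eq0 negb_or => /andP[_].
by rewrite mcoeff_neq0; exact: Pf.
Qed.

Lemma fparityM d e f g :
  fparity d f -> fparity e g -> fparity (d (+) e) (f * g).
Proof.
move=> Pf Pg m /msuppM_le[m1 [m2 [/Pf <- /Pg <- ->]]].
by rewrite fdegM oddD.
Qed.

Lemma fparity1 : fparity false 1.
Proof.
move=> m; rewrite -mcoeff_neq0 mcoeff1; case: (m =P mone) => [->|_]; last by rewrite eqxx.
by rewrite fdeg1.
Qed.

Lemma fparityU i : fparity true (<< fmu i >> : freealg2).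
Proof.
move=> m; rewrite -mcoeff_neq0 mcoeffU1; case: (fmu i =P m) => [<-|_]; last by rewrite eqxx.
by rewrite fdegU.
Qed.

Lemma fprojM e f g : fproj e (f * g) =
  fproj false f * fproj e g + fproj true f * fproj (~~ e) g.
Proof.
have Pd d d' : fparity (d (+) d') (fproj d f * fproj d' g).
  by apply: fparityM; apply: fprojP.
have P1 d d' : d (+) d' = e ->
    fproj e (fproj d f * fproj d' g) = fproj d f * fproj d' g.
  by move=> <-; apply: fproj_id.
have P0 d d' : d (+) d' = ~~ e -> fproj e (fproj d f * fproj d' g) = 0.
  by move=> de; apply: fproj_0; rewrite -de.
have E d : fproj e (fproj d f * g) = fproj d f * fproj (d (+) e) g.
  have -> : fproj d f * g =
      fproj d f * fproj (d (+) e) g + fproj d f * fproj (~~ (d (+) e)) g.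
    by rewrite -mulrDr -fproj_split.
  rewrite fprojD; apply: etrans (addr0 _); congr (_ + _).
    by apply: P1; rewrite addbA addbb.
  by apply: P0; case: (d) (e) => [] [].
have -> : f * g = fproj false f * g + fproj true f * g.
  by rewrite -mulrDl -(fproj_split false).
by rewrite fprojD; congr (_ + _); [exact: (E false)|exact: (E true)].
Qed.

Lemma sjp_rels_parity r : r \in sjp_rels -> exists e, fparity e r.
Proof.
have [PX PY] : fparity true freeX /\ fparity true freeY by split; apply: fparityU.
have PZ : fparity false freeZ by apply: fparityD; apply: (@fparityM true true).
rewrite !inE => /orP[/eqP ->|/eqP ->]; [exists false|exists true].
  by rewrite expr2; apply: (@fparityM true true).
apply: fparityB; [apply: fparityB|].
- exact: (@fparityM true false).
- exact: (@fparityM false true).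
- exact: (@fparityM true false).
Qed.

Lemma sjp_ideal_fproj f : f \in sjp_ideal -> forall e, fproj e f \in sjp_ideal.
Proof.
move=> /ideal_predP; elim=> [r rR||g h _ IHg _ IHh|a g _ IH|a g _ IH] e.
- have [d Pr] := sjp_rels_parity rR.
  have [<-|de] := eqVneq d e.
    by rewrite fproj_id //; apply/ideal_predP; apply: ideal_gen_rel.
  rewrite fproj_0 ?rpred0 //.
  by have <- : d = ~~ e by case: (d) (e) de => [] [].
- by rewrite fproj_id ?rpred0 //; apply: fparity0.
- by rewrite fprojB; apply: rpredB; [exact: IHg|exact: IHh].
- by rewrite fprojM; apply: rpredD; apply: ideal_predMl; exact: IH.
- by rewrite fprojM; apply: rpredD; apply: ideal_predMr; exact: IH.
Qed.

(* f@_mone is the constant term of f. *)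
Lemma sjp_ideal_counit f : f \in sjp_ideal -> f@_mone = 0.
Proof.
pose eps : {rmorphism freealg2 -> k} := mcoeff (mone : {fmonom 'I_2}).
have U0 i : eps << fmu i >> = 0 by rewrite /eps /= mcoeffU1 fm1_eq1.
apply: (ideal_pred_rmorph (phi := eps)) => r.
rewrite !inE => /orP[/eqP ->|/eqP ->].
  by apply: etrans (rmorphXn eps 2 freeX) _; rewrite (U0 0) expr0n.
exact: augmentation_rel (U0 0) (U0 1).
Qed.

Lemma sjp_ideal_proper : 1 \notin sjp_ideal.
Proof.
apply/negP => /sjp_ideal_counit; rewrite mcoeff1 eqxx => /eqP.
by rewrite oner_eq0.
Qed.

End Ideal.

(* The quotient algebra; ring_quotient only provides the ring structure for
   ideals of commutative rings. *)

Definition sjp (k : fieldType) : Type := Quotient.quot (@sjp_ideal k).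
HB.instance Definition _ k := GRing.Zmodule.on (sjp k).

Section Projection.
Variable k : fieldType.
Local Notation freealg2 := (freealg2 k).
Local Notation sjp := (sjp k).
Local Notation sjp_ideal := (@sjp_ideal k).

Definition sjp_pi (f : freealg2) : sjp := \pi_(Quotient.quot sjp_ideal)%qT f.
Definition sjp_repr (u : sjp) : freealg2 := repr (u : Quotient.quot sjp_ideal).

Lemma sjp_reprK : cancel sjp_repr sjp_pi.
Proof. by move=> u; exact: reprK. Qed.

Lemma sjp_pi_eq f g : sjp_pi f = sjp_pi g <-> f - g \in sjp_ideal.
Proof.
rewrite -/(Quotient.equiv _ f g); split=> [/eqP|] fg.
  by rewrite Quotient.equivE Quotient.idealrBE.
by apply/eqP; rewrite -Quotient.idealrBE -Quotient.equivE.
Qed.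

Lemma sjp_piB : {morph sjp_pi : f g / f - g}.
Proof. by move=> f g; exact: (raddfB \pi_(Quotient.quot sjp_ideal)%qT). Qed.

HB.instance Definition _ := GRing.isZmodMorphism.Build freealg2 sjp sjp_pi sjp_piB.

End Projection.

HB.lock Definition sjp_mul (k : fieldType) (u v : sjp k) : sjp k :=
  sjp_pi (sjp_repr u * sjp_repr v).
HB.lock Definition sjp_scale (k : fieldType) (c : k) (u : sjp k) : sjp k :=
  sjp_pi (c *: sjp_repr u).

Section SuperJordanPlane.
Variable k : fieldType.
Local Notation freealg2 := (freealg2 k).
Local Notation sjp := (sjp k).
Local Notation sjp_ideal := (@sjp_ideal k).
Local Notation sjp_pi := (@sjp_pi k).
Local Notation sjp_mul := (@sjp_mul k).
Local Notation sjp_scale := (@sjp_scale k).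

Definition sjp_one : sjp := sjp_pi 1.

Lemma sjp_pi_reprB f : sjp_repr (sjp_pi f) - f \in sjp_ideal.
Proof. by apply/sjp_pi_eq; rewrite sjp_reprK. Qed.

Lemma sjp_pi_mul f g : sjp_mul (sjp_pi f) (sjp_pi g) = sjp_pi (f * g).
Proof.
rewrite unlock; apply/sjp_pi_eq.
by apply: ideal_pred_mulB; exact: sjp_pi_reprB.
Qed.

Lemma sjp_pi_scale c f : sjp_scale c (sjp_pi f) = sjp_pi (c *: f).
Proof.
rewrite unlock; apply/sjp_pi_eq.
by apply: ideal_pred_scaleB; exact: sjp_pi_reprB.
Qed.

Lemma sjp_ind (P : sjp -> Prop) : (forall f, P (sjp_pi f)) -> forall u, P u.
Proof. by move=> Ppi u; rewrite -[u]sjp_reprK. Qed.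

Lemma sjp_mulA : associative sjp_mul.
Proof.
by do 3![elim/sjp_ind=> ?]; rewrite !sjp_pi_mul mulrA.
Qed.

Lemma sjp_mul1 : left_id sjp_one sjp_mul.
Proof. by elim/sjp_ind=> f; rewrite sjp_pi_mul mul1r. Qed.

Lemma sjp_mulr1 : right_id sjp_one sjp_mul.
Proof. by elim/sjp_ind=> f; rewrite sjp_pi_mul mulr1. Qed.

Lemma sjp_mulDl : left_distributive sjp_mul +%R.
Proof.
by do 3![elim/sjp_ind=> ?]; rewrite -raddfD !sjp_pi_mul -raddfD mulrDl.
Qed.

Lemma sjp_mulDr : right_distributive sjp_mul +%R.
Proof.
by do 3![elim/sjp_ind=> ?]; rewrite -raddfD !sjp_pi_mul -raddfD mulrDr.
Qed.

Lemma sjp_one_neq0 : sjp_one != 0.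
Proof.
apply/eqP; rewrite -(raddf0 sjp_pi) => /sjp_pi_eq; rewrite subr0.
exact/negP/sjp_ideal_proper.
Qed.

HB.instance Definition _ := GRing.Zmodule_isNzRing.Build sjp
  sjp_mulA sjp_mul1 sjp_mulr1 sjp_mulDl sjp_mulDr sjp_one_neq0.

Lemma sjp_scaleA a b u : sjp_scale a (sjp_scale b u) = sjp_scale (a * b) u.
Proof. by elim/sjp_ind: u => f; rewrite !sjp_pi_scale scalerA. Qed.

Lemma sjp_scale1 : left_id 1 sjp_scale.
Proof. by elim/sjp_ind=> f; rewrite sjp_pi_scale scale1r. Qed.

Lemma sjp_scaleDr : right_distributive sjp_scale +%R.
Proof.
by move=> a; do 2![elim/sjp_ind=> ?]; rewrite -raddfD !sjp_pi_scale -raddfD scalerDr.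
Qed.

Lemma sjp_scaleDl u : {morph sjp_scale^~ u : a b / a + b}.
Proof.
by elim/sjp_ind: u => f a b; rewrite !sjp_pi_scale -raddfD scalerDl.
Qed.

HB.instance Definition _ := GRing.Zmodule_isLmodule.Build k sjp
  sjp_scaleA sjp_scale1 sjp_scaleDr sjp_scaleDl.

Lemma sjp_scaleAl (c : k) (u v : sjp) : c *: (u * v) = (c *: u) * v.
Proof.
elim/sjp_ind: u => f; elim/sjp_ind: v => g.
by rewrite /GRing.scale /= /GRing.mul /= !(sjp_pi_scale, sjp_pi_mul) scalerAl.
Qed.

HB.instance Definition _ := GRing.Lmodule_isLalgebra.Build k sjp sjp_scaleAl.

Lemma sjp_scaleAr (c : k) (u v : sjp) : c *: (u * v) = u * (c *: v).
Proof.
elim/sjp_ind: u => f; elim/sjp_ind: v => g.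
by rewrite /GRing.scale /= /GRing.mul /= !(sjp_pi_scale, sjp_pi_mul) freealg2_scalerAr.
Qed.

HB.instance Definition _ := GRing.Lalgebra_isAlgebra.Build k sjp sjp_scaleAr.

Lemma sjp_pi_monoid_morphism : monoid_morphism sjp_pi.
Proof. by split=> // f g; symmetry; exact: sjp_pi_mul. Qed.

HB.instance Definition _ :=
  GRing.isMonoidMorphism.Build freealg2 sjp sjp_pi sjp_pi_monoid_morphism.

Lemma sjp_piZ : scalable sjp_pi.
Proof. by move=> c f; symmetry; exact: sjp_pi_scale. Qed.

HB.instance Definition _ := GRing.isScalable.Build k freealg2 sjp *:%R sjp_pi sjp_piZ.

Definition sjpX : sjp := sjp_pi (freeX k).
Definition sjpY : sjp := sjp_pi (freeY k).
Definition sjpZ : sjp := sjpX * sjpY + sjpY * sjpX.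

Lemma sjp_relX : sjpX ^+ 2 = 0.
Proof.
rewrite -rmorphXn -(raddf0 sjp_pi); apply/sjp_pi_eq; rewrite subr0.
by apply/ideal_predP/ideal_gen_rel; rewrite !inE eqxx.
Qed.

Lemma sjp_relY : sjpY * sjpZ - sjpZ * sjpY - sjpX * sjpZ = 0.
Proof.
rewrite /sjpZ -!rmorphM -raddfD -!rmorphM -!raddfB -(raddf0 sjp_pi).
apply/sjp_pi_eq; rewrite subr0.
by apply/ideal_predP/ideal_gen_rel; rewrite !inE eqxx orbT.
Qed.

(* The image in the quotient of the span of the words of length n. *)
Definition sjp_component (n : nat) (u : sjp) : Prop :=
  exists2 f : freealg2, (forall m, m \in msupp f -> fdeg m = n) & u = sjp_pi f.

(* The sum of the components of degree n, over n even when e = false, over n odd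
   when e = true. *)
Definition sjp_part (e : bool) (u : sjp) : Prop :=
  exists (N : nat) (c : nat -> sjp),
    (forall n, sjp_component n (c n)) /\ u = \sum_(n < N | odd n == e) c n.

Lemma sjp_partP e u :
  sjp_part e u <-> exists2 f, fparity e f & u = sjp_pi f.
Proof.
split=> [[N [c [Pc ->]]]|[f Pf ->]].
  elim/big_ind: _ => [|_ _ [f Pf ->] [g Pg ->]|i /eqP ie].
  - by exists 0; [apply: fparity0|rewrite raddf0].
  - by exists (f + g); [apply: fparityD|rewrite raddfD].
  - by have [f Pf ->] := Pc i; exists f => // m /Pf ->.
pose h n : freealg2 := \sum_(m <- msupp f | fdeg m == n) << f@_m *g m >>.
exists (mmeasure (@fdeg _) f), (fun n => sjp_pi (h n)); split=> [n|].
  exists (h n) => // m; rewrite -mcoeff_neq0; apply: contraNeq => mn.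
  rewrite raddf_sum big1 //= => i /eqP iN; rewrite mcoeffU; case: eqP => // im.
  by rewrite -im iN eqxx in mn.
rewrite -raddf_sum; congr sjp_pi; rewrite {1}[f]monalgE.
rewrite (exchange_big_dep xpredT) //= big_seq [RHS]big_seq.
apply: eq_bigr => m mf; have lt := mmeasure_mnm_lt (@fdeg _) mf.
rewrite (bigD1 (Ordinal lt)) /=; last by rewrite (Pf _ mf) !eqxx.
rewrite big1 ?addr0 // => i /andP[/andP[_ /eqP mi]].
by case/negP; apply/eqP/val_inj.
Qed.

Lemma sjp_part0 e : sjp_part e 0.
Proof.
by apply/sjp_partP; exists 0; [exact: fparity0|rewrite raddf0].
Qed.

Lemma sjp_part_linear e (a : k) u v :
  sjp_part e u -> sjp_part e v -> sjp_part e (a *: u + v).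
Proof.
move=> /sjp_partP[f Pf ->] /sjp_partP[g Pg ->]; apply/sjp_partP.
exists (a *: f + g); first by apply: fparityD => //; apply: fparityZ.
by rewrite raddfD -sjp_piZ.
Qed.

Lemma sjp_part1 : sjp_part false 1.
Proof. by apply/sjp_partP; exists 1; [exact: fparity1|rewrite rmorph1]. Qed.

Lemma sjp_partM d e u v :
  sjp_part d u -> sjp_part e v -> sjp_part (d (+) e) (u * v).
Proof.
move=> /sjp_partP[f Pf ->] /sjp_partP[g Pg ->]; apply/sjp_partP.
by exists (f * g); [exact: fparityM|rewrite rmorphM].
Qed.

Lemma sjp_part_sum u : exists u0 u1,
  [/\ sjp_part false u0, sjp_part true u1 & u = u0 + u1].
Proof.
elim/sjp_ind: u => f; exists (sjp_pi (fproj false f)), (sjp_pi (fproj true f)).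
split; [apply/sjp_partP|apply/sjp_partP|].
- by exists (fproj false f) => //; exact: fprojP.
- by exists (fproj true f) => //; exact: fprojP.
- by rewrite -raddfD -(fproj_split false).
Qed.

Lemma sjp_part_direct u : sjp_part false u -> sjp_part true u -> u = 0.
Proof.
move=> /sjp_partP[f Pf ->] /sjp_partP[g Pg] /sjp_pi_eq /sjp_ideal_fproj/(_ false).
rewrite fprojB (fproj_id Pf) (fproj_0 (e := false) Pg) => If.
by rewrite -(raddf0 sjp_pi); apply/sjp_pi_eq.
Qed.

Definition super_jordan_plane : superalgType k :=
  @SuperAlg k sjp sjp_part sjp_part0 sjp_part_linear sjp_part1 sjp_partM
    sjp_part_sum sjp_part_direct.

End SuperJordanPlane.

(* Main.v *)
Require Import Defs.
From HB Require Import structures.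
From mathcomp Require Import all_boot all_algebra boolp monalg ring.

Set Implicit Arguments.
Unset Strict Implicit.
Unset Printing Implicit Defensive.

Import GRing.Theory.
Local Open Scope ring_scope.

(** Write w = y^2.  The defining relations give x z = z x, y z = z y + x z and
    y x = z - x y, so every element of the super Jordan plane can be reordered
    into a normal form A + x B + C y + x D y, where A, B, C, D are combinations
    of the monomials z^i w^j ([sjp_normal_form]).

    The elements z and w satisfy w z - z w = z^2, so they generate a Jordan
    plane, which is a domain: it acts on P = k[z][w], with z multiplying and w
    acting as W = w + z^2 d/dz, and since W raises the degree in w by exactly
    one, the degrees of A and of the element acted on add up.  A nonzero A
    therefore kills no nonzero element of P ([jordan_act_inj]).

    Over the Jordan plane the super Jordan plane consists of 2 x 2 matrices,
    x being z E_12 and y being w E_12 + E_21.  Letting these matrices act on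
    P * P gives a representation of the algebra ([sjp_lift] applied to
    [jordan_x] and [jordan_y]), in which the normal form above is the matrix
    with rows (A + z D, z B + C w) and (C, A).  So an element that kills both
    (q, 0) and (0, q) for one nonzero q is zero ([phi_inj_at]); in particular
    the representation is faithful.

    If f r g = 0 for all r and g is nonzero, then g v = (a, b) is nonzero for
    some v.  The elements x and x y send (a, b) to (z b, 0)
    and (z a, 0), and y sends (q, 0) to (0, q); hence f kills (q, 0) and (0, q)
    for q one of z a, z b, chosen nonzero, and f = 0 ([prime_of_jordan_rep]). *)

(** * The ring of additive endomorphisms *)

Section EndoRing.
Variable V : zmodType.

Record endo :=
  Endo { endo_fun :> V -> V; endo_additive : zmod_morphism endo_fun }.

HB.instance Definition _ := gen_eqMixin endo.
HB.instance Definition _ := gen_choiceMixin endo.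
HB.instance Definition _ (a : endo) :=
  GRing.isZmodMorphism.Build V V a (endo_additive a).

Implicit Types a b c : endo.

Lemma endoP a b : (forall v, a v = b v) -> a = b.
Proof.
case: a b => [f fB] [g gB] /= /funext fg.
by rewrite fg in fB *; congr Endo; apply: Prop_irrelevance.
Qed.

Lemma endo0_subproof : zmod_morphism (fun _ : V => 0 : V).
Proof. by move=> u v; rewrite subr0. Qed.
Lemma endo1_subproof : zmod_morphism (fun v : V => v).
Proof. by []. Qed.
Lemma endoN_subproof a : zmod_morphism (fun v => - a v).
Proof. by move=> u v; rewrite raddfB opprD. Qed.
Lemma endoD_subproof a b : zmod_morphism (fun v => a v + b v).
Proof. by move=> u v; rewrite !raddfB opprD addrACA. Qed.
Lemma endoM_subproof a b : zmod_morphism (fun v => a (b v)).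
Proof. by move=> u v; rewrite !raddfB. Qed.

Let add a b := Endo (endoD_subproof a b).
Let opp a := Endo (endoN_subproof a).
Let mul a b := Endo (endoM_subproof a b).

Fact endo_addA : associative add.
Proof. by move=> a b c; apply: endoP => v; apply: addrA. Qed.
Fact endo_addC : commutative add.
Proof. by move=> a b; apply: endoP => v; apply: addrC. Qed.
Fact endo_add0 : left_id (Endo endo0_subproof) add.
Proof. by move=> a; apply: endoP => v; apply: add0r. Qed.
Fact endo_addN : left_inverse (Endo endo0_subproof) opp add.
Proof. by move=> a; apply: endoP => v; apply: addNr. Qed.

HB.instance Definition _ :=
  GRing.isZmodule.Build endo endo_addA endo_addC endo_add0 endo_addN.

Fact endo_mulA : associative mul.
Proof. by move=> a b c; apply: endoP. Qed.
Fact endo_mul1 : left_id (Endo endo1_subproof) mul.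
Proof. by move=> a; apply: endoP. Qed.
Fact endo_mulr1 : right_id (Endo endo1_subproof) mul.
Proof. by move=> a; apply: endoP. Qed.
Fact endo_mulDl : left_distributive mul +%R.
Proof. by move=> a b c; apply: endoP. Qed.
Fact endo_mulDr : right_distributive mul +%R.
Proof. by move=> a b c; apply: endoP => v; apply: (raddfD a). Qed.

HB.instance Definition _ := GRing.Zmodule_isPzRing.Build endo
  endo_mulA endo_mul1 endo_mulr1 endo_mulDl endo_mulDr.

Lemma endo0E v : (0 : endo) v = 0. Proof. by []. Qed.
Lemma endo1E v : (1 : endo) v = v. Proof. by []. Qed.
Lemma endoDE a b v : (a + b) v = a v + b v. Proof. by []. Qed.
Lemma endoNE a v : (- a) v = - a v. Proof. by []. Qed.
Lemma endoME a b v : (a * b) v = a (b v). Proof. by []. Qed.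

Definition endoE := (endo0E, endo1E, endoDE, endoNE, endoME).
End EndoRing.

Section Scale.
Variables (R : comPzRingType) (M : lmodType R).

Lemma endo_scale_subproof (a : R) : zmod_morphism (fun v : M => a *: v).
Proof. by move=> u v; rewrite scalerBr. Qed.
Definition endo_scale a : endo M := Endo (endo_scale_subproof a).

Lemma endo_scaleB : zmod_morphism endo_scale.
Proof. by move=> a b; apply: endoP => v; apply: scalerBl. Qed.
Lemma endo_scaleM : monoid_morphism endo_scale.
Proof.
by split=> [|a b]; apply: endoP => v; [apply: scale1r|symmetry; apply: scalerA].
Qed.
HB.instance Definition _ :=
  GRing.isZmodMorphism.Build R (endo M) endo_scale endo_scaleB.
HB.instance Definition _ :=
  GRing.isMonoidMorphism.Build R (endo M) endo_scale endo_scaleM.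
End Scale.

(** * Normal forms in an algebra satisfying the relations *)

Section NormalForm.
Variables (k : fieldType) (R : algType k).

(** The value of a polynomial in two variables at two elements that need not
    commute, with the powers of z written to the left of those of w: the
    coefficient ring {poly k} carries z and the outer variable is w. *)
Definition zw_eval (z w : R) (A : {poly {poly k}}) : R :=
  (map_poly (horner_alg z) A).[w].

Lemma zw_evalD z w A B : zw_eval z w (A + B) = zw_eval z w A + zw_eval z w B.
Proof. by rewrite /zw_eval rmorphD hornerD. Qed.

Lemma zw_evalN z w A : zw_eval z w (- A) = - zw_eval z w A.
Proof. by rewrite /zw_eval rmorphN hornerN. Qed.

Lemma zw_evalC z w p : zw_eval z w p%:P = horner_alg z p.
Proof. by rewrite /zw_eval map_polyC hornerC. Qed.

Lemma zw_evalMX z w A : zw_eval z w (A * 'X) = zw_eval z w A * w.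
Proof. by rewrite /zw_eval rmorphM /= map_polyX hornerMX. Qed.

Lemma zw_evalZ z w p A : zw_eval z w (p *: A) = horner_alg z p * zw_eval z w A.
Proof. by rewrite /zw_eval linearZ /= hornerZ. Qed.

Lemma comm_horner_alg (u z : R) (p : {poly k}) :
  GRing.comm u z -> GRing.comm u (horner_alg z p).
Proof.
move=> uz; elim/poly_ind: p => [|p c IH].
  by rewrite raddf0; exact: commr0.
rewrite rmorphD rmorphM /= horner_algX horner_algC.
by apply: commrD; [exact: commrM|exact/commr_sym/comm_alg].
Qed.

Variables (x y z w : R).
Local Notation sigma := (zw_eval z w).

Definition normal_form (A B C D : {poly {poly k}}) : R :=
  sigma A + x * sigma B + sigma C * y + x * sigma D * y.

Lemma normal_form1 : 1 = normal_form 1 0 0 0.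
Proof.
rewrite /normal_form /zw_eval rmorph1 hornerC raddf0 horner0.
by rewrite !(mulr0, mul0r) !addr0.
Qed.

Lemma normal_form_linear c A B C D A' B' C' D' :
  c *: normal_form A B C D + normal_form A' B' C' D' =
  normal_form (c%:P *: A + A') (c%:P *: B + B') (c%:P *: C + C')
    (c%:P *: D + D').
Proof.
have E T T' : sigma (c%:P *: T + T') = c *: sigma T + sigma T'.
  by rewrite zw_evalD zw_evalZ horner_algC mulr_algl.
rewrite /normal_form !E !scalerDr !(mulrDl, mulrDr) -!(scalerAl, scalerAr).
by rewrite [LHS](AC (4*4) ((1*5)*(2*6)*(3*7)*(4*8))).
Qed.

Hypothesis zE : z = x * y + y * x.
Hypothesis wE : w = y ^+ 2.
Hypothesis xx0 : x ^+ 2 = 0.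
Hypothesis yzE : y * z - z * y - x * z = 0.

Let xz : GRing.comm x z.
Proof.
by rewrite /GRing.comm zE mulrDl mulrDr mulrA -expr2 xx0 mul0r add0r
  -!mulrA -expr2 xx0 mulr0 addr0.
Qed.

Let yz : y * z = z * y + x * z.
Proof. by apply/eqP; rewrite -subr_eq0 opprD addrA yzE. Qed.

Let yx : y * x = z - x * y.
Proof. by rewrite zE addrC addKr. Qed.

(** Moving y past z^i creates i x z^i, because y z = z y + x z and x z = z x,
    while y commutes with w; only the shape of the correction term matters. *)
Lemma y_zw_eval A : exists A', y * sigma A = sigma A * y + x * sigma A'.
Proof.
have yp (p : {poly k}) : exists p', y * horner_alg z p =
    horner_alg z p * y + x * horner_alg z p'.
  elim/poly_ind: p => [|p c [p' IH]].
    by exists 0; rewrite !raddf0 !(mulr0, mul0r) addr0.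
  exists ('X * p + p' * 'X).
  rewrite !(rmorphD, rmorphM) /= !horner_algX horner_algC.
  have cx : y * c%:A = c%:A * y by rewrite mulr_algr mulr_algl.
  rewrite mulrDr mulrA IH cx !mulrDl !mulrDr -!mulrA yz mulrDr.
  have -> : horner_alg z p * (x * z) = x * (z * horner_alg z p).
    have [xp zp] := (comm_horner_alg p xz, comm_horner_alg p (commr_refl z)).
    by rewrite zp !mulrA -xp.
  by rewrite [LHS](AC (3*1) (1*4*(2*3))).
elim/poly_ind: A => [|A p [A' IH]].
  by exists 0; rewrite /zw_eval !raddf0 !horner0 !(mulr0, mul0r) addr0.
have [p' pE] := yp p; exists (A' * 'X + p'%:P).
rewrite !(zw_evalD, zw_evalMX, zw_evalC) mulrDr pE mulrA IH !mulrDl mulrDr.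
have yw : y * w = w * y by rewrite wE -exprSr -exprS.
by rewrite -!mulrA yw addrACA.
Qed.

Lemma mulx_normal_form A B C D :
  x * normal_form A B C D = normal_form 0 A 0 C.
Proof.
rewrite /normal_form /zw_eval raddf0 horner0 add0r mul0r addr0 !mulrDr !mulrA.
by rewrite -expr2 xx0 !mul0r !addr0.
Qed.

(** With [normal_form1], [normal_form_linear] and [mulx_normal_form], this shows
    that every element of the subalgebra generated by x and y is a normal form.
    The rewriting uses y x = z - x y, x^2 = 0 and y^2 = w. *)
Lemma muly_normal_form A B C D : exists A' C',
  y * normal_form A B C D =
  normal_form ('X *: B + C * 'X) (A' - D * 'X) (A + 'X *: D) (C' - B).
Proof.
have [[A' AE] [C' CE]] := (y_zw_eval A, y_zw_eval C); exists A', C'.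
have yxs B0 : y * (x * sigma B0) = z * sigma B0 - x * sigma B0 * y.
  have [B' BE] := y_zw_eval B0.
  by rewrite mulrA yx mulrBl -(mulrA x y) BE mulrDr !mulrA -expr2
    xx0 mul0r addr0.
rewrite /normal_form !(zw_evalD, zw_evalN, zw_evalZ, zw_evalMX) horner_algX.
rewrite !mulrDr AE yxs (mulrA y (sigma C)) CE (mulrA y _ y) yxs.
rewrite !mulrDl !(mulNr, mulrN) -!mulrA -[y * y]expr2 -wE.
by rewrite [LHS](AC (((2*2)*2)*2) ((3*5)*(2*8)*(1*7)*(6*4))).
Qed.

End NormalForm.

(** * The Jordan plane acting on polynomials *)

Section JordanAction.
Variable k : fieldType.
Local Notation P := {poly {poly k}}.
Implicit Types (p : {poly k}) (q A : P).

(** The operator w + z^2 d/dz on k[z][w], whose commutator with the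
    multiplication by z is the multiplication by z^2. *)
Definition jordan_w q : P := q * 'X + 'X ^+ 2 *: map_poly (@deriv k) q.

Lemma jordan_wB : zmod_morphism jordan_w.
Proof.
by move=> q r; rewrite /jordan_w mulrBl raddfB scalerBr opprD addrACA.
Qed.
HB.instance Definition _ := GRing.isZmodMorphism.Build P P jordan_w jordan_wB.

Lemma jordan_wZ p q :
  jordan_w (p *: q) = p *: jordan_w q + ('X ^+ 2 * p^`()) *: q.
Proof.
apply/polyP=> i; rewrite /jordan_w -scalerAl !(coefD, coefZ, coef_map) /=.
by rewrite derivM; ring.
Qed.

Lemma size_jordan_w q : q != 0 -> size (jordan_w q) = (size q).+1.
Proof.
move=> q0; rewrite /jordan_w size_polyDl size_mulX // ltnS.
exact: leq_trans (size_scale_leq _ _) (size_poly _ _).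
Qed.

(** The action on k[z][w] of the operator sum_i A_i(z) W^i, W being
    [jordan_w]. *)
Definition jordan_act A q : P := \sum_(i < size A) A`_i *: iter i jordan_w q.

Lemma jordan_act_wide n A q : (size A <= n)%N ->
  jordan_act A q = \sum_(i < n) A`_i *: iter i jordan_w q.
Proof.
move=> leAn; rewrite /jordan_act.
rewrite (big_ord_widen n (fun i => A`_i *: iter i jordan_w q)) //.
rewrite big_mkcond; apply: eq_bigr => i _; case: ltnP => // le.
by rewrite nth_default // scale0r.
Qed.

Lemma jordan_actMXaddC A p q :
  jordan_act (A * 'X + p%:P) q = jordan_act A (jordan_w q) + p *: q.
Proof.
rewrite (jordan_act_wide (n := (size A).+1)) ?size_MXaddC; last by case: ifP.
rewrite big_ord_recl addrC coefD coefMX coefC add0r; congr (_ + _).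
by apply: eq_bigr => i _; rewrite coefD coefMX coefC addr0 /= -iterSr.
Qed.

Lemma jordan_act0 q : jordan_act 0 q = 0.
Proof. by rewrite /jordan_act size_poly0 big_ord0. Qed.

Lemma jordan_actr0 A : jordan_act A 0 = 0.
Proof.
elim/poly_ind: A => [|A p IH]; first exact: jordan_act0.
by rewrite jordan_actMXaddC raddf0 IH scaler0 addr0.
Qed.

(** As [jordan_w] raises the degree in w by one, only the leading term of A
    contributes to the top degree. *)
Lemma size_jordan_act A q : A != 0 -> q != 0 ->
  size (jordan_act A q) = (size A + size q).-1.
Proof.
elim/poly_ind: A q => [|A p IH] q; first by rewrite eqxx.
rewrite jordan_actMXaddC size_MXaddC => Ap0 q0.
have [A0|A0] := eqVneq A 0.
  move: Ap0; rewrite A0 mul0r add0r polyC_eq0 => p0.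
  rewrite (negPf p0) /= jordan_act0 add0r.
  by rewrite size_scale // size_poly0.
have sw := size_jordan_w q0.
have w0 : jordan_w q != 0 by rewrite -size_poly_eq0 sw.
rewrite size_polyDl (IH _ A0 w0) sw /=; first by rewrite addnS.
rewrite addnS /= (leq_ltn_trans (size_scale_leq _ _)) //.
by rewrite -[X in (X < _)%N]add0n ltn_add2r size_poly_gt0.
Qed.

Lemma jordan_act_inj A q : q != 0 -> jordan_act A q = 0 -> A = 0.
Proof.
move=> q0 Aq0; apply/eqP; apply: contraTT isT => A0.
have := size_jordan_act A0 q0; rewrite Aq0 size_poly0.
move: A0 q0; rewrite -!size_poly_gt0.
by case: (size A) (size q) => [|a] [|b] //; rewrite addnS.
Qed.

Local Notation V := (P * P)%type.

Lemma endo_neq0 : (1 : endo V) != 0.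
Proof.
apply/eqP => /(congr1 (fun a : endo V => (a (1, 0)).1)) /= /eqP.
by rewrite oner_eq0.
Qed.
HB.instance Definition _ := GRing.PzSemiRing_isNonZero.Build (endo V) endo_neq0.

Lemma jordan_x_subproof : zmod_morphism (fun v : V => ('X *: v.2, 0) : V).
Proof. by move=> u v; rewrite scalerBr; congr pair; rewrite subr0. Qed.
Lemma jordan_y_subproof : zmod_morphism (fun v : V => (jordan_w v.2, v.1) : V).
Proof. by move=> u v; rewrite raddfB. Qed.

(** The matrices z E_12 and w E_12 + E_21 acting on column vectors, so that
    x y + y x is the scalar matrix z. *)
Definition jordan_x : endo V := Endo jordan_x_subproof.
Definition jordan_y : endo V := Endo jordan_y_subproof.
Definition jordan_scalar : k -> endo V := (@endo_scale {poly k} V) \o polyC.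
HB.instance Definition _ := GRing.RMorphism.on jordan_scalar.

Let z := jordan_x * jordan_y + jordan_y * jordan_x.

Lemma jordan_zE v : z v = 'X *: v.
Proof.
case: v => a b; rewrite /z !endoE /= raddf0.
by congr pair; rewrite /= ?addr0 ?add0r.
Qed.

Lemma jordan_xx0 : jordan_x ^+ 2 = 0.
Proof. by apply: endoP => v; rewrite expr2 endoME /= scaler0. Qed.

Lemma jordan_yz : jordan_y * z - z * jordan_y - jordan_x * z = 0.
Proof.
apply: endoP => -[a b]; rewrite !(jordan_zE, endoE) /=.
congr pair; rewrite /= ?subr0 ?subrr //.
by rewrite jordan_wZ derivX mulr1 (addrC ('X *: _)) addrK scalerA -expr2 subrr.
Qed.

Lemma jordan_scalar_comm_x c : GRing.comm (jordan_scalar c) jordan_x.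
Proof.
apply: endoP => -[a b]; rewrite !endoE /=; congr pair; rewrite /= ?scaler0 //.
by rewrite !scalerA mulrC.
Qed.

Lemma jordan_scalar_comm_y c : GRing.comm (jordan_scalar c) jordan_y.
Proof.
apply: endoP => -[a b]; rewrite !endoE /=; congr pair => /=.
by rewrite jordan_wZ derivC mulr0 scale0r addr0.
Qed.
End JordanAction.

(** * Primeness from the representation *)

Section Prime.
Variables (k : fieldType) (R : algType k) (x y : R).
Local Notation P := {poly {poly k}}.
Local Notation V := (P * P)%type.
Variable phi : {rmorphism R -> endo V}.
Hypothesis phix : phi x = jordan_x k.
Hypothesis phiy : phi y = jordan_y k.
Hypothesis phik : forall c : k, phi c%:A = jordan_scalar c.

Let z := x * y + y * x.
Let w := y ^+ 2.

Hypothesis nfP : forall u : R, exists A B C D, u = normal_form x y z w A B C D.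

Lemma phi_horner p v : phi (horner_alg z p) v = p *: v.
Proof.
have phiz u : phi z u = 'X *: u.
  by rewrite rmorphD !rmorphM phix phiy jordan_zE.
elim/poly_ind: p v => [|p c IH] v; first by rewrite !raddf0 scale0r.
rewrite !(rmorphD, rmorphM) /= horner_algX horner_algC phik phiz IH scalerDl.
by rewrite scalerA.
Qed.

Lemma phi_zw_eval A a b :
  phi (zw_eval z w A) (a, b) = (jordan_act A a, jordan_act A b).
Proof.
elim/poly_ind: A a b => [|A p IH] a b.
  by rewrite /zw_eval raddf0 horner0 raddf0 !jordan_act0.
have phiw : phi w (a, b) = (jordan_w a, jordan_w b).
  by rewrite rmorphXn phiy.
rewrite zw_evalD zw_evalMX zw_evalC !jordan_actMXaddC.
by rewrite rmorphD rmorphM !endoE phi_horner phiw IH.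
Qed.

Lemma scaleX_eq0 q : ('X *: q == 0 :> P) = (q == 0).
Proof. by rewrite -mul_polyC mulf_eq0 polyC_eq0 polyX_eq0. Qed.

(** The images of (q, 0) and (0, q) are the columns of the matrix of f applied
    to q.  The second row gives C = A = 0, and then the first gives
    z D = z B = 0. *)
Lemma phi_inj_at q f : q != 0 -> phi f (q, 0) = 0 -> phi f (0, q) = 0 -> f = 0.
Proof.
move=> q0; have [A [B [C [D ->]]]] := nfP f.
rewrite /normal_form !(rmorphD, rmorphM) /= phix phiy.
rewrite !phi_zw_eval /=.
have w0 : jordan_w (0 : P) = 0 by exact: raddf0.
rewrite w0 !jordan_actr0 scaler0 => fq0 f0q.
move: (congr1 fst fq0) (congr1 snd fq0) (congr1 fst f0q) (congr1 snd f0q).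
rewrite /= !(addr0, add0r) => AD /(jordan_act_inj q0) C0 +
  /(jordan_act_inj q0) A0.
move: AD; rewrite C0 A0 !jordan_act0 add0r addr0.
have X0 (r : P) : 'X *: r = 0 -> r = 0.
  by move=> /eqP; rewrite scaleX_eq0 => /eqP.
move=> /X0 /(jordan_act_inj q0) D0 /X0 /(jordan_act_inj q0) B0.
by rewrite D0 B0 /zw_eval raddf0 horner0 !(mulr0, mul0r) !addr0.
Qed.

(** A nonzero g moves some vector to (a, b) <> 0, whose orbit contains (q, 0)
    and (0, q) for some nonzero q; f kills the whole orbit. *)
Lemma prime_of_jordan_rep f g : (forall r : R, f * r * g = 0) -> f = 0 \/ g = 0.
Proof.
move=> frg; have [->|g0] := eqVneq g 0; first by right.
left.
have fB r v : phi f (phi r (phi g v)) = 0.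
  have -> : phi f (phi r (phi g v)) = phi (f * r * g) v by rewrite !rmorphM.
  by rewrite frg raddf0.
have [v gv] : exists v, phi g v != 0.
  apply: contrapT => gv0; case/eqP: g0.
  have gv v : phi g v = 0 by apply: contrapT => /eqP gv; case: gv0; exists v.
  exact: (@phi_inj_at 1 g (oner_neq0 _)).
case: (phi g v) (fB^~ v) gv => a b {}fB ab0.
(* Multiplying r by y on the left yields (0, q) as well. *)
have kill q : q != 0 -> (exists r, phi r (a, b) = (q, 0)) -> f = 0.
  move=> q0 [r rq]; apply: (phi_inj_at q0); first by rewrite -rq fB.
  by have := fB (y * r); rewrite rmorphM endoME rq phiy /= raddf0.
have [a0|a0] := eqVneq a 0.
  apply: (kill ('X *: b)); last by exists x; rewrite phix.
  by rewrite scaleX_eq0; apply: contraNneq ab0 => ->; rewrite a0.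
apply: (kill ('X *: a)); first by rewrite scaleX_eq0.
by exists (x * y); rewrite rmorphM endoME phix phiy.
Qed.
End Prime.

(** * The universal property and the spanning set of the super Jordan plane *)

(** Kept in abstract rings so that the product of the free algebra is never
    unfolded when its second relation is evaluated. *)
Lemma rmorph_sjp_rel (A S : nzRingType) (phi : {rmorphism A -> S})
    (x y : A) (X Y : S) : phi x = X -> phi y = Y ->
  Y * (X * Y + Y * X) - (X * Y + Y * X) * Y - X * (X * Y + Y * X) = 0 ->
  phi (y * (x * y + y * x) - (x * y + y * x) * y - x * (x * y + y * x)) = 0.
Proof. by move=> <- <-; rewrite !(rmorphB, rmorphD, rmorphM). Qed.

Section Universal.
Variables (k : fieldType) (S : nzRingType) (iota : {rmorphism k -> S}).
Variables (X Y : S).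
Local Notation Z := (X * Y + Y * X).

Definition word_eval (m : {fmonom 'I_2}) : S :=
  \prod_(i <- (m : seq 'I_2)) (if i == 0 then X else Y).

Lemma word_eval_mmorphism : mmorphism word_eval.
Proof.
split=> [m1 m2|]; first by rewrite /word_eval fmM big_cat.
by rewrite /word_eval fm1 big_nil.
Qed.
HB.instance Definition _ :=
  isMultiplicative.Build {fmonom 'I_2} S word_eval word_eval_mmorphism.

Hypothesis iotaX : forall c, GRing.comm (iota c) X.
Hypothesis iotaY : forall c, GRing.comm (iota c) Y.

Lemma free_lift : exists psi : {rmorphism freealg2 k -> S},
  [/\ psi (freeX k) = X, psi (freeY k) = Y & forall c, psi (c *: 1) = iota c].
Proof.
pose ev : freealg2 k -> S := mmap iota word_eval.
have evB : zmod_morphism ev by exact: mmap_is_additive.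
have evM : monoid_morphism ev.
  have [evM ev1] : multiplicative ev.
    apply: commr_mmap_is_multiplicative => g m m'; rewrite /= /word_eval.
    elim/big_ind: _ => [|a b|i _]; [exact: commr1|exact: commrM|].
    by case: ifP.
  by split.
have evU i : ev << fmu i >> = if i == 0 then X else Y.
  have -> : ev << fmu i >> = iota 1 * word_eval (fmu i) by exact: mmapU.
  by rewrite rmorph1 mul1r /word_eval fmU big_seq1.
exists (HB.pack_for {rmorphism freealg2 k -> S} ev
  (GRing.isZmodMorphism.Build _ _ ev evB)
  (GRing.isMonoidMorphism.Build _ _ ev evM)).
split=> [||c] /=; [exact: evU|exact: evU|].
have -> : ev (c *: 1) = iota c * ev 1 by exact: mmapZ.
by rewrite evM.1 mulr1.
Qed.

Hypothesis XX0 : X ^+ 2 = 0.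
Hypothesis YZ : Y * Z - Z * Y - X * Z = 0.

(** The universal property of the presentation, for rings S that receive k
    through a morphism whose values commute with X and Y. *)
Lemma sjp_lift : exists phi : {rmorphism sjp k -> S},
  [/\ phi (sjpX k) = X, phi (sjpY k) = Y & forall c, phi c%:A = iota c].
Proof.
have [psi [psiX psiY psik]] := free_lift.
have psiI f : f \in @sjp_ideal k -> psi f = 0.
  apply: ideal_pred_rmorph => r; rewrite !inE => /orP[/eqP ->|/eqP ->].
    by rewrite rmorphXn psiX.
  exact: rmorph_sjp_rel psiX psiY YZ.
pose phi (u : sjp k) := psi (sjp_repr u).
have phiE f : phi (sjp_pi f) = psi f.
  apply/eqP; rewrite -subr_eq0; apply/eqP.
  by apply: etrans (esym (raddfB psi _ _)) (psiI _ (sjp_pi_reprB f)).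
have phiB : zmod_morphism phi.
  by elim/sjp_ind=> f; elim/sjp_ind=> g; rewrite -raddfB !phiE raddfB.
have phiM : monoid_morphism phi.
  split=> [|]; first by rewrite -(rmorph1 (@sjp_pi k)) phiE rmorph1.
  by elim/sjp_ind=> f; elim/sjp_ind=> g; rewrite -rmorphM !phiE rmorphM.
pose Phi : {rmorphism sjp k -> S} := HB.pack phi
  (GRing.isZmodMorphism.Build _ _ phi phiB)
  (GRing.isMonoidMorphism.Build _ _ phi phiM).
exists Phi; split=> [||c]; [by rewrite /= phiE|by rewrite /= phiE|].
by rewrite -(rmorph1 (@sjp_pi k)) -sjp_piZ /= phiE.
Qed.
End Universal.

(** Induction on words: a subspace containing 1 and stable under left
    multiplication by the generators is everything. *)
Lemma sjp_spanned (k : fieldType) (P : sjp k -> Prop) :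
  P 1 -> (forall c u v, P u -> P v -> P (c *: u + v)) ->
  (forall u, P u -> P (sjpX k * u)) -> (forall u, P u -> P (sjpY k * u)) ->
  forall u, P u.
Proof.
move=> P1 PL PX PY.
have P0 : P 0 by rewrite -(addNr (1 : sjp k)) -scaleN1r; apply: PL.
have Pw (s : seq 'I_2) : P (sjp_pi << FMonom s >>).
  elim: s => [|i s IH].
    by rewrite -fmoneE -/(1 : freealg2 k) rmorph1.
  have -> : << FMonom (i :: s) >> = << fmu i >> * << FMonom s >> :> freealg2 k.
    rewrite malgM_def (fgmulUU 1 1) mulr1; congr mkmalgU.
    by rewrite /mmul /= fmmulE fmuE.
  rewrite rmorphM; case: (eqVneq i 0) => [->|i0]; first exact: PX.
  have -> : i = 1 by apply: val_inj; case: i i0 => -[|[|]].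
  exact: PY.
elim/sjp_ind=> f; rewrite [f]monalgE raddf_sum.
elim/big_ind: _ => // [u v Pu Pv|m _].
  by rewrite -[u]scale1r; apply: PL.
have mE : f@_m *: sjp_pi << FMonom m >> + 0 = sjp_pi << f@_m *g m >>.
  rewrite addr0 -sjp_piZ; congr sjp_pi; apply/malgP => m'.
  by rewrite mcoeffZ !mcoeffU fmK mulrnAr mulr1.
by have := PL f@_m _ _ (Pw m) P0; rewrite mE.
Qed.

Lemma sjp_normal_form (k : fieldType) (u : sjp k) : exists A B C D,
  u = normal_form (sjpX k) (sjpY k) (sjpZ k) (sjpY k ^+ 2) A B C D.
Proof.
elim/sjp_spanned: u => [|c _ _ [A [B [C [D ->]]]] [A' [B' [C' [D' ->]]]]
    |_ [A [B [C [D ->]]]]|_ [A [B [C [D ->]]]]].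
- by exists 1, 0, 0, 0; exact: normal_form1.
- by do 4!eexists; exact: normal_form_linear.
- by do 4!eexists; exact: (mulx_normal_form _ _ _ (sjp_relX k)).
- have [A' [C' ->]] := muly_normal_form (erefl (sjpZ k)) (erefl (sjpY k ^+ 2))
    (sjp_relX k) (sjp_relY k) A B C D.
  by do 4!eexists.
Qed.

Theorem theorem4p8 (k : fieldType) (char_k : 2%N \notin [pchar k]%R) :
  super_prime (super_jordan_plane k).
Proof.
have [phi [phix phiy phik]] := sjp_lift (@jordan_scalar_comm_x k)
  (@jordan_scalar_comm_y k) (@jordan_xx0 k) (@jordan_yz k).
move=> f g _ _; apply: (prime_of_jordan_rep phix phiy phik).
exact: sjp_normal_form.
Qed.
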